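(* Let $n\ge 1$, let $G$ be a subgroup of the group $\mathbb{B}_n\subset \mathrm{GL}(n,\mathbb{Z})$ of signed permutation matrices of size $n$, let $K/F$ be a finite Galois extension with Galois group $G$ (that is, equipped with a fixed isomorphism $\iota: G\to \mathrm{Gal}(K/F)$), and let $\alpha\in K$ be a normal element for $K/F$. Let $G$ act on the rational function field $K(x_1,\ldots,x_n)$ by acting on $K$ through $\iota$ and by permuting the indeterminates $x_1,\ldots,x_n$ up to inversion according to the signed permutation matrices in $G$ (as specified in the context). Then $$K(x_1,\ldots,x_n)^G = F(y_1,\ldots,y_n),$$ where $$y_i = \sum_{g\in G} g\left(\frac{\alpha}{1+x_i}\right),\qquad i=1,\ldots,n.$$
   Context: A signed permutation matrix of size $n$ is an $n\times n$ matrix with exactly one non-zero entry in each row and each column, that entry being $1$ or $-1$. Normal element: for a finite Galois extension $K/F$, an element $\alpha\in K$ is normal if $\alpha$ and all its Galois conjugates form an $F$-basis of $K$, i.e. $\{\sigma(\alpha):\sigma\in \mathrm{Gal}(K/F)\}$, indexed by $\mathrm{Gal}(K/F)$, is an $F$-basis of $K$. Action of $G$: let $\mathbf{e}_1,\ldots,\mathbf{e}_n$ be the standard basis (column vectors) of $\mathbb{Z}^n$, on which $G\le \mathrm{GL}(n,\mathbb{Z})$ acts by left multiplication. Given the isomorphism $\iota: G\to\mathrm{Gal}(K/F)$, the group $G$ acts by field automorphisms on $K(x_1,\ldots,x_n)$, where $x_1,\ldots,x_n$ are indeterminates over $K$, as follows: for $g\in G$ and $\beta\in K$, $g(\beta)=(\iota(g))(\beta)$;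 and for $g\in G$ and $1\le i\le n$, $g(x_i)=\prod_{j=1}^n x_j^{g_{j,i}}$, where $g_{j,i}$ is the $(j,i)$ entry of $g$. For a signed permutation matrix $g$ this means $g(x_i)=x_j$ if $g(\mathbf{e}_i)=\mathbf{e}_j$, and $g(x_i)=x_j^{-1}$ if $g(\mathbf{e}_i)=-\mathbf{e}_j$. $K(x_1,\ldots,x_n)^G$ denotes the subfield of elements fixed by all of $G$, and $F(y_1,\ldots,y_n)$ denotes the subfield of $K(x_1,\ldots,x_n)$ generated over $F$ by $y_1,\ldots,y_n$. *)

(* Defs.v *)
From HB Require Import structures.
From mathcomp Require Import all_boot all_order all_fingroup all_algebra.
From mathcomp Require Import all_field.
From mathcomp Require Import generic_quotient fraction.
From mathcomp Require Import mpoly.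

Set Implicit Arguments.
Unset Strict Implicit.
Unset Printing Implicit Defensive.

Import GRing.Theory Num.Theory.
Local Open Scope ring_scope.

Section SignedPerm.
Variable n : nat.
Implicit Types A B : 'M[int]_n.

Definition is_signed_perm_mx A : bool :=
  [&& [forall i, #|[set j | A i j != 0]| == 1%N],
      [forall j, #|[set i | A i j != 0]| == 1%N]
    & [forall i, forall j, (A i j != 0) ==> (A i j == 1) || (A i j == -1)]].

Record signed_perm : predArgType :=
  SignedPerm {sp_mx :> 'M[int]_n; sp_mxP : is_signed_perm_mx sp_mx}.

HB.instance Definition _ := [isSub for sp_mx].
HB.instance Definition _ := [Countable of signed_perm by <:].

Lemma signed_perm_mxP A :
  reflect (exists s : 'S_n, exists e : 'I_n -> bool,
             forall i j, A i j = (-1) ^+ e i *+ (s i == j))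
          (is_signed_perm_mx A).
Proof.
have sgn_eq0 (b : bool) : ((-1) ^+ b : int) != 0 by rewrite signr_eq0.
apply: (iffP and3P) => [[/forallP rA /forallP cA /forallP eA] | [s [e defA]]].
  have /fin_all_exists [f fE] i : exists j, [set j | A i j != 0] = [set j].
    by apply/cards1P; apply: rA.
  have nzE i j : (A i j != 0) = (f i == j).
    by have /setP/(_ j) := fE i; rewrite !inE => ->; apply: eq_sym.
  have f_inj : injective f.
    move=> i i' eqf; have /cards1P[k /setP kE] := cA (f i).
    have := kE i; have := kE i'; rewrite !inE !nzE eqf eqxx.
    by move=> /esym/eqP -> /esym/eqP ->.
  exists (perm f_inj); exists (fun i => A i (f i) == -1) => i j.
  rewrite permE; have [<- | ] := eqVneq (f i) j; last first.
    by rewrite -nzE negbK => /eqP.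
  have /forallP/(_ (f i)) := eA i; rewrite nzE eqxx /=.
  by case/orP => /eqP ->.
have nzE i j : (A i j != 0) = (s i == j).
  by rewrite defA; case: (s i == j); rewrite ?sgn_eq0 ?mulr0n ?eqxx.
split; apply/forallP.
- move=> i; apply/cards1P; exists (s i); apply/setP => j.
  by rewrite !inE nzE eq_sym.
- move=> j; apply/cards1P; exists ((s^-1)%g j); apply/setP => i.
  by rewrite !inE nzE -(inj_eq (@perm_inj _ s^-1%g)) permK.
move=> i; apply/forallP => j; rewrite nzE defA; case: (s i == j) => //=.
by case: (e i).
Qed.

Definition sp_tab (g : signed_perm) : 'M[bool * bool]_n :=
  map_mx (fun z => (z == 1, z == -1)) g.
Definition sp_untab (T : 'M[bool * bool]_n) : option signed_perm :=
  insub (map_mx (fun b => if b.1 then 1 else if b.2 then -1 else 0) T).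
Lemma sp_tabK : pcancel sp_tab sp_untab.
Proof.
move=> g; rewrite /sp_untab; set T := map_mx _ (sp_tab g).
suff -> : T = sp_mx g by exact: valK.
have /signed_perm_mxP[s [e gE]] := sp_mxP g.
by apply/matrixP => i j; rewrite !mxE /= gE; case: (s i == j); case: (e i).
Qed.
HB.instance Definition _ : isFinite signed_perm := PCanIsFinite sp_tabK.

Lemma signed_perm1 : is_signed_perm_mx 1%:M.
Proof.
apply/signed_perm_mxP; exists 1%g; exists (fun=> false) => i j.
by rewrite mxE perm1 expr0.
Qed.

Lemma signed_permM A B :
  is_signed_perm_mx A -> is_signed_perm_mx B -> is_signed_perm_mx (A *m B).
Proof.
move=> /signed_perm_mxP[s [e sE]] /signed_perm_mxP[t [f tE]].
apply/signed_perm_mxP; exists (s * t)%g; exists (fun i => e i (+) f (s i)) => i j.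
rewrite mxE (bigD1 (s i)) //= big1 ?addr0 => [|k /negPf nk].
  by rewrite sE tE eqxx permM signr_addb mulrnAr.
by rewrite sE eq_sym nk mul0r.
Qed.

Lemma signed_permT A : is_signed_perm_mx A -> is_signed_perm_mx A^T.
Proof.
move=> /signed_perm_mxP[s [e sE]]; apply/signed_perm_mxP.
exists s^-1%g; exists (fun i => e ((s^-1)%g i)) => i j; rewrite mxE sE.
rewrite -(inj_eq (@perm_inj _ s^-1%g)) permK eq_sym.
by case: eqP => // ->.
Qed.

Lemma signed_permTK A : is_signed_perm_mx A -> A^T *m A = 1%:M.
Proof.
move=> /signed_perm_mxP[s [e sE]]; apply/matrixP => i j; rewrite !mxE.
rewrite (bigD1 ((s^-1)%g i)) //= big1 ?addr0 => [|k nk].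
  by rewrite mxE !sE permKV eqxx mulrnAr -expr2 sqrr_sign.
rewrite mxE sE; case: eqP => [sk | _]; last by rewrite mul0r.
by rewrite -sk permK eqxx in nk.
Qed.

Definition sp_one := SignedPerm signed_perm1.
Definition sp_mul (g h : signed_perm) :=
  SignedPerm (signed_permM (sp_mxP g) (sp_mxP h)).
Definition sp_inv (g : signed_perm) := SignedPerm (signed_permT (sp_mxP g)).

Lemma sp_mulA : associative sp_mul.
Proof. by move=> f g h; apply: val_inj; rewrite /= mulmxA. Qed.
Lemma sp_mul1 : left_id sp_one sp_mul.
Proof. by move=> g; apply: val_inj; rewrite /= mul1mx. Qed.
Lemma sp_mulV : left_inverse sp_one sp_inv sp_mul.
Proof. by move=> g; apply: val_inj; rewrite /= signed_permTK ?sp_mxP. Qed.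
HB.instance Definition _ :=
  Finite_isGroup.Build signed_perm sp_mulA sp_mul1 sp_mulV.

End SignedPerm.

Notation ratfun K n := {fraction {mpoly K[n]}}.

Section RationalFunctions.
Variables (K : fieldType) (n : nat).
Local Notation "p %:F" := (@FracField.tofrac {mpoly K[n]} p).

Definition ratC (c : K) : ratfun K n := (c%:MP)%:F.
Definition ratX (i : 'I_n) : ratfun K n := ('X_i)%:F.

HB.instance Definition _ := GRing.RMorphism.copy ratC
  (@FracField.tofrac {mpoly K[n]} \o @mpolyC n K).

Lemma ratfun_repr (f : ratfun K n) :
  f = (\n_(repr f))%:F / (\d_(repr f))%:F.
Proof.
rewrite -{1}[f]reprK; move: (repr f) => x.
rewrite [RHS]/GRing.mul /= [X in FracField.mul _ X]/GRing.inv /= !piE.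
rewrite /FracField.mulf /FracField.invf /=.
rewrite !(fun y => numer_Ratio y (oner_neq0 _)).
rewrite !(fun y => denom_Ratio y (oner_neq0 _)).
by rewrite !numden_Ratio ?denom_ratioP // mulr1 mul1r Ratio_numden.
Qed.

Section Action.
Variables (s : {rmorphism K -> K}) (g : signed_perm n).

Definition sp_poly : {mpoly K[n]} -> ratfun K n :=
  mmap (ratC \o s) (fun i => \prod_(j < n) ratX j ^ g j i).

HB.instance Definition _ := GRing.RMorphism.copy sp_poly
  (mmap (ratC \o s) (fun i => \prod_(j < n) ratX j ^ g j i)).

(* The result does not depend on the representative, sp_poly being an
   injective ring morphism: see sp_act_frac, sp_actC and sp_actX. *)
Definition sp_act (f : ratfun K n) : ratfun K n :=
  sp_poly (\n_(repr f)) / sp_poly (\d_(repr f)).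

Let ratX_neq0 i : ratX i != 0.
Proof.
rewrite tofrac_eq0; apply/eqP => /(congr1 (mcoeff U_(i))) /eqP.
by rewrite mcoeffXU eqxx mcoeff0 oner_eq0.
Qed.

Let w (m : 'X_{1..n}) (j : 'I_n) : int := \sum_i g j i * (m i)%:Z.

Let w_inj (m m' : 'X_{1..n}) : w m =1 w m' -> m = m'.
Proof.
move=> eqw; pose v (m : 'X_{1..n}) : 'cV[int]_n := \col_i (m i)%:Z.
have gv k : sp_mx g *m v k = \col_j w k j.
  by apply/colP => j; rewrite !mxE; apply: eq_bigr => i _; rewrite mxE.
have : v m = v m'.
  rewrite -[v m]mul1mx -[v m']mul1mx -(signed_permTK (sp_mxP g)) -!mulmxA !gv.
  by congr (_ *m _); apply/colP => j; rewrite !mxE eqw.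
by move/colP => eqv; apply/mnmP => i; have := eqv i; rewrite !mxE => -[].
Qed.

Let sp_poly_monom (m : 'X_{1..n}) :
  mmap1 (fun i => \prod_(j < n) ratX j ^ g j i) m = \prod_j ratX j ^ w m j.
Proof.
rewrite /mmap1 -[LHS]/(\prod_i _).
under eq_bigr do rewrite -prodrXl.
rewrite exchange_big /=; apply: eq_bigr => j _.
rewrite (big_morph (fun z => ratX j ^ z) (id1 := 1) (op1 := *%R)) //; last first.
  by move=> a b; rewrite expfzDr.
by apply: eq_bigr => i _; rewrite -exprz_exp.
Qed.

Lemma sp_poly_eq0 p : (sp_poly p == 0) = (p == 0).
Proof.
apply/eqP/eqP => [p0 | ->]; last exact: rmorph0.
apply/eqP; apply/negPn/negP => nzp.
pose N := (\sum_(m <- msupp p) \sum_j `|w m j|)%N.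
pose h m : 'X_{1..n} := [multinom absz (N%:Z + w m j)%R | j < n].
have hE m j : m \in msupp p -> (h m j)%:Z = N%:Z + w m j.
  move=> mp; rewrite mnmE gez0_abs // -lerBlDr sub0r.
  apply: (@Order.POrderTheory.le_trans _ _ `|w m j|).
    by rewrite -normrN ler_norm.
  rewrite -abszE lez_nat /N (big_rem m) //= (bigD1 j) //= -addnA.
  exact: leq_addr.
pose q : {mpoly K[n]} := \sum_(m <- msupp p) (s p@_m)%:MP * 'X_[h m].
have qE : q%:F = (\prod_j ratX j ^ N%:Z) * sp_poly p.
  rewrite /sp_poly /mmap mulr_sumr rmorph_sum big_seq [RHS]big_seq.
  apply: eq_bigr => m mp; rewrite rmorphM /= mulrCA; congr (_ * _).
  rewrite sp_poly_monom -big_split /= mpolyXE_id rmorph_prod.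
  apply: eq_bigr => j _; rewrite rmorphXn /= exprnP.
  by rewrite hE // expfzDr // ratX_neq0.
have q0 : q = 0 by apply/eqP; rewrite -tofrac_eq0 qE p0 mulr0.
have mp := mlead_supp nzp; have := congr1 (mcoeff (h (mlead p))) q0.
rewrite mcoeff0 /q raddf_sum /= (bigD1_seq (mlead p)) //= big_seq_cond big1.
  rewrite addr0 mcoeffCM mcoeffX eqxx mulr1 => /eqP.
  by rewrite fmorph_eq0; apply/negP; rewrite -mcoeff_msupp.
move=> m /andP[mp' ne]; rewrite mcoeffCM mcoeffX; case: eqP => [eqh|_].
  case/eqP: ne; apply: w_inj => j; apply: (addrI N%:Z).
  by rewrite -!hE // eqh.
by rewrite mulr0.
Qed.

Lemma sp_act_frac p q : q != 0 -> sp_act (p%:F / q%:F) = sp_poly p / sp_poly q.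
Proof.
move=> nzq; rewrite /sp_act; set f := p%:F / q%:F.
have := ratfun_repr f; have := denom_ratioP (repr f); rewrite {2}/f.
move: (\n_(repr f)) (\d_(repr f)) => a b nzb /eqP.
rewrite eqr_div ?tofrac_eq0 // -!tofracM tofrac_eq => /eqP eqpa.
by apply/eqP; rewrite eqr_div ?sp_poly_eq0 // -!rmorphM eqpa.
Qed.

Lemma sp_act_tofrac p : sp_act p%:F = sp_poly p.
Proof.
by rewrite -[p%:F]divr1 -(rmorph1 (@FracField.tofrac {mpoly K[n]}))
   sp_act_frac ?oner_neq0 // rmorph1 divr1.
Qed.

Lemma sp_actC c : sp_act (ratC c) = ratC (s c).
Proof. by rewrite sp_act_tofrac /sp_poly mmapC. Qed.

Lemma sp_actX i : sp_act (ratX i) = \prod_(j < n) ratX j ^ g j i.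
Proof. by rewrite sp_act_tofrac /sp_poly mmapX mmap1U. Qed.

Fact sp_act_is_zmod_morphism : zmod_morphism sp_act.
Proof.
move=> e f; rewrite [e]ratfun_repr [f]ratfun_repr.
move: (repr e) (repr f) => [[a b] /= b0] [[c d] /= d0].
rewrite -mulNr addf_div ?tofrac_eq0 // -tofracN -!tofracM -tofracD.
rewrite !sp_act_frac ?mulf_neq0 // -mulNr addf_div ?sp_poly_eq0 //.
by rewrite rmorphD !rmorphM rmorphN.
Qed.

Fact sp_act_is_monoid_morphism : monoid_morphism sp_act.
Proof.
split=> [|e f]; first by rewrite -(rmorph1 ratC) sp_actC !rmorph1.
rewrite [e]ratfun_repr [f]ratfun_repr.
move: (repr e) (repr f) => [[a b] /= b0] [[c d] /= d0].
rewrite mulf_div -!tofracM !sp_act_frac ?mulf_neq0 //.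
by rewrite mulf_div -!rmorphM.
Qed.

HB.instance Definition _ := GRing.isZmodMorphism.Build
  (ratfun K n) (ratfun K n) sp_act sp_act_is_zmod_morphism.
HB.instance Definition _ := GRing.isMonoidMorphism.Build
  (ratfun K n) (ratfun K n) sp_act sp_act_is_monoid_morphism.

End Action.
End RationalFunctions.

Definition normal_element (F : fieldType) (K : splittingFieldType F) (a : K) :=
  basis_of {:K} [seq sigma a | sigma : gal_of {:K} in 'Gal({:K} / 1)%g].

(* Composition in Gal(K/F) is taken here from right to left, as the action
   below is on the left, whereas the product x * y of gal_of {:K} applies x
   first; hence iota is not a {morphism G >-> gal_of {:K}}. *)
Definition galois_iso (n : nat) (F : fieldType) (K : splittingFieldType F)
    (G : {group signed_perm n}) (iota : signed_perm n -> gal_of {:K}) : Prop :=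
  [/\ {in G &, forall g h a, iota (g * h)%g a = iota g (iota h a)},
      {in G &, injective iota}
    & iota @: G = 'Gal({:K} / 1)%g].

Definition is_subfield (E : fieldType) (S : E -> Prop) : Prop :=
  [/\ S 1, forall a b, S a -> S b -> S (a - b)
    & forall a b, S a -> S b -> S (a / b)].

Definition subfield_gen (E : fieldType) (A : E -> Prop) (f : E) : Prop :=
  forall S : E -> Prop, is_subfield S -> (forall a, A a -> S a) -> S f.

Section Fields.
Variables (n : nat) (F : fieldType) (K : splittingFieldType F).

(* F(y_0, ..., y_(n-1)) in K(x_0, ..., x_(n-1)) *)
Definition adjoin_ratfun (y : 'I_n -> ratfun K n) : ratfun K n -> Prop :=
  subfield_gen (fun a => (exists c : F, a = ratC n c%:A) \/ (exists i, a = y i)).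

Definition fixed_ratfun (G : {group signed_perm n})
    (iota : signed_perm n -> gal_of {:K}) (f : ratfun K n) : Prop :=
  forall g, g \in G -> sp_act (iota g) g f = f.
End Fields.

(* Main.v *)
Require Import Defs.
From mathcomp Require Import all_boot all_order all_fingroup all_algebra.
From mathcomp Require Import all_field.
From mathcomp Require Import generic_quotient fraction.
From mathcomp Require Import mpoly.

Set Implicit Arguments.
Unset Strict Implicit.
Unset Printing Implicit Defensive.

Import GRing.Theory Num.Theory.
Local Open Scope ring_scope.

(** Put z_i = 1 / (1 + x_i). Since 1 / (1 + x_i^-1) = 1 - z_i, a signed
    permutation of the x_i acts on the z_i by an affine map ([sp_act_affX]), so
    that y = A z + b, where b has entries in K and
    A_ij = sum_g g(alpha) g_ji ([twist_mx]).

    The matrix A is invertible ([twist_mx_unit]). Applying h in G to its entries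
    multiplies it by the matrix of h on the right, so its left kernel is stable
    under Gal(K/F). If that kernel is not 0, scaling one of its vectors and
    taking the trace of a multiple of it gives a nonzero vector w over F.
    Reading w A = 0 as an F-linear relation between the conjugates of alpha,
    the normality of alpha gives g w = 0 for every g in G, hence w = 0.

    Thus z = A^-1 (y - b), so x is rational in y over K, and
    K(x_1, ..., x_n) is generated by K and L = F(y_1, ..., y_n). The y_i
    are sums over an orbit, so L consists of G-invariants. It remains to see
    that every invariant is in L ([fixed_field_descent]): the K-span T of L is a
    ring; an invariant f of T is in L because T is mapped to L by the trace
    over G, and the trace of alpha f is the product of f and the nonzero scalar
    Tr(alpha) of F; finally T is a field, because an element of T divides its
    norm over G, an invariant of T. So T is all of K(x_1, ..., x_n). *)

(** * The conjugates of a normal element *)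

Section NormalElement.
Variables (n : nat) (F : fieldType) (K : splittingFieldType F).
Variables (G : {group signed_perm n}) (iota : signed_perm n -> gal_of {:K}).
Hypotheses (hK : galois 1 {:K}) (hiota : galois_iso G iota).
Variable alpha : K.
Hypothesis halpha : normal_element alpha.

Lemma fixed_scalar (c : K) :
  (forall g, g \in G -> iota g c = c) -> exists a : F, c = a%:A.
Proof.
have [_ _ imG] := hiota => fixc.
suff: c \in 1%VS by case/vlineP=> a ->; exists a.
move/galois_fixedField: hK => <-.
apply/fixedFieldP; first exact: memvf.
by rewrite -imG => _ /imsetP[g Gg ->]; apply: fixc.
Qed.

(** The basis in the definition of a normal element is indexed by Gal(K/F);
    here it is indexed by G, through [iota]. *)
Lemma normal_free (k : signed_perm n -> F) :
  \sum_(g in G) k g *: iota g alpha = 0 -> forall g, g \in G -> k g = 0.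
Proof.
have [_ injG imG] := hiota.
have /freeP freeA := basis_free halpha.
(* The transport of [k] to Gal(K/F) along the inverse of [iota]. *)
pose k' s := odflt 0 (omap k [pick g in G | iota g == s]).
have k'E g : g \in G -> k' (iota g) = k g.
  move=> Gg; rewrite /k'; case: pickP => [h /andP[Gh /eqP /injG ->] // |].
  by move/(_ g); rewrite Gg eqxx.
move=> sum0 g Gg; have iG : iota g \in 'Gal({:K} / 1)%g by rewrite -imG imset_f.
rewrite -k'E // -(enum_rankK_in iG iG).
apply: (freeA (fun i => k' (enum_val i))).
rewrite -[RHS]sum0; under eq_bigr do rewrite nth_image.
rewrite -(big_enum_val (fun s => k' s *: s alpha)) -imG big_imset //=.
by apply: eq_bigr => h Gh; rewrite k'E.
Qed.

Lemma iota_mul g h c : g \in G -> h \in G -> iota (g * h)%g c = iota g (iota h c).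
Proof. by move=> Gg Gh; have [iM _ _] := hiota; rewrite iM. Qed.

Lemma iota1 c : iota 1%g c = c.
Proof.
have := iota_mul c (group1 G) (group1 G).
by rewrite mulg1 => /esym; apply: fmorph_inj.
Qed.

Definition trace (c : K) := \sum_(g in G) iota g c.

Lemma trace_scalar c : exists a : F, trace c = a%:A.
Proof.
apply: fixed_scalar => h Gh; rewrite rmorph_sum.
rewrite [RHS](reindex_inj (mulgI h)); apply: eq_big => g; rewrite ?groupMl //.
by move=> Gg; rewrite iota_mul.
Qed.

(** A vanishing trace would be a relation between the conjugates of [alpha]
    with all coefficients equal to 1. *)
Lemma trace_normal : trace alpha != 0.
Proof.
apply/eqP=> tr0; have /eqP := oner_neq0 F; apply.
apply: (normal_free (k := fun=> 1) _ (group1 G)).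
by rewrite -[RHS]tr0; apply: eq_bigr => g _; rewrite scale1r.
Qed.

(** The linear part of y as a function of z = 1 / (1 + x). *)
Definition twist_mx : 'M[K]_n :=
  \matrix_(i, j) \sum_(g in G) iota g alpha * (g j i)%:~R.

(** Substituting [h * g] for [g] in the product on the right turns its
    integral factor into [h^T * (h * g)], which is [g] as [h] is orthogonal. *)
Lemma twist_mxJ h : h \in G ->
  map_mx (iota h) twist_mx = twist_mx *m map_mx intr (sp_mx h).
Proof.
move=> Gh; apply/matrixP=> i j; rewrite !mxE rmorph_sum.
under [RHS]eq_bigr do rewrite !mxE mulr_suml.
rewrite exchange_big /= [RHS](reindex_inj (mulgI h)) /=.
apply: eq_big => g; first by rewrite groupMl.
move=> Gg; rewrite rmorphM rmorph_int iota_mul //=.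
under eq_bigr do rewrite -mulrA -intrM.
rewrite -mulr_sumr -rmorph_sum; congr (_ * _%:~R).
have := congr1 (fun M : 'M_n => M j i) (mulmxA (sp_mx h)^T (sp_mx h) (sp_mx g)).
rewrite /= signed_permTK ?sp_mxP // mul1mx => <-.
by rewrite mxE; apply: eq_bigr => k _; rewrite [_^T _ _]mxE mulrC.
Qed.

(** The left kernel is stable under Gal(K/F) by [twist_mxJ], so if it is
    nonzero it has a nonzero vector over F, on which the normality of [alpha]
    applies. *)
Lemma twist_mx_unit : twist_mx \in unitmx.
Proof.
rewrite -row_free_unit -kermx_eq0; apply/rowV0P => v /sub_kermxP vA0.
apply/eqP/negPn/negP => /rV0Pn[i vi_neq0].
(* An entry equal to 1 makes the [i]-th entry of [w] below equal to the trace
   of [alpha], which is nonzero. *)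
pose u := (v 0 i)^-1 *: v.
have uA0 : u *m twist_mx = 0 by rewrite -scalemxAl vA0 scaler0.
have ui : u 0 i = 1 by rewrite mxE mulVf.
pose w : 'rV[K]_n := \row_j trace (alpha * u 0 j).
have wA0 : w *m twist_mx = 0.
  have -> : w = \sum_(h in G) iota h alpha *: map_mx (iota h) u.
    apply/rowP=> j; rewrite summxE mxE; apply: eq_bigr => h _.
    by rewrite !mxE rmorphM.
  rewrite mulmx_suml big1 // => h Gh; rewrite -scalemxAl.
  suff -> : map_mx (iota h) u *m twist_mx = 0 by rewrite scaler0.
  have hU : (map_mx intr (sp_mx h) : 'M[K]_n) \in unitmx.
    suff /mulmx1_unit[] :
      (map_mx intr (sp_mx h)^T : 'M[K]_n) *m map_mx intr (sp_mx h) = 1%:M by [].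
    by rewrite -map_mxM signed_permTK ?sp_mxP // map_mx1.
  apply: (can_inj (mulmxK hU)).
  by rewrite mul0mx -mulmxA -twist_mxJ // -map_mxM uA0 map_mx0.
have /fin_all_exists[a wE] j : exists a : F, w 0 j = a%:A.
  by rewrite mxE; apply: trace_scalar.
suff ai0 : a i = 0.
  have /eqP := trace_normal; apply.
  by rewrite -[alpha]mulr1 -ui; have := wE i; rewrite mxE => ->; rewrite ai0 scale0r.
(* The sum is the [i]-th coordinate of [g w] for [g = 1]; all coordinates of
   all [g w] vanish. *)
suff <- : \sum_(i' < n) a i' *~ (1%g : signed_perm n) i i' = a i.
  apply: (normal_free (k := fun g => \sum_(i' < n) a i' *~ g i i') _ (group1 G)).
  have /rowP/(_ i) := wA0; rewrite mxE [RHS]mxE => wAi0; rewrite -[RHS]wAi0.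
  under [RHS]eq_bigr do rewrite [twist_mx _ _]mxE mulr_sumr.
  rewrite exchange_big /=; apply: eq_bigr => g _.
  rewrite scaler_suml; apply: eq_bigr => i' _.
  by rewrite wE mulr_algl mulrzr -scalerMzl scalerMzr.
rewrite (bigD1 i) //= mxE eqxx big1 ?addr0 // => j /negPf ji.
by rewrite mxE eq_sym ji.
Qed.
End NormalElement.

(** * Subfields given as predicates *)

Section Subfields.
Variable E : fieldType.
Implicit Types S A : E -> Prop.

Lemma subfield0 S : is_subfield S -> S 0.
Proof. by case=> S1 SB _; rewrite -(subrr 1); apply: SB. Qed.

Lemma subfieldN S a : is_subfield S -> S a -> S (- a).
Proof.
by move=> fS Sa; rewrite -sub0r; case: (fS) => _ SB _; apply: SB; first exact: subfield0.
Qed.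

Lemma subfieldD S a b : is_subfield S -> S a -> S b -> S (a + b).
Proof.
move=> fS Sa Sb; rewrite -[b]opprK; case: (fS) => _ SB _.
by apply: SB => //; apply: subfieldN.
Qed.

Lemma subfieldV S a : is_subfield S -> S a -> S a^-1.
Proof. by case=> S1 _ SV Sa; rewrite -div1r; apply: SV. Qed.

Lemma subfieldM S a b : is_subfield S -> S a -> S b -> S (a * b).
Proof.
move=> fS Sa Sb; rewrite -[b]invrK; case: (fS) => _ _ SV.
by apply: SV => //; apply: subfieldV.
Qed.

Lemma subfield_sum S (I : Type) (r : seq I) (P : pred I) (f : I -> E) :
  is_subfield S -> (forall i, P i -> S (f i)) -> S (\sum_(i <- r | P i) f i).
Proof.
move=> fS Sf; apply: big_ind => //; first exact: subfield0.
by move=> a b; apply: subfieldD.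
Qed.

Lemma subfieldX S a m : is_subfield S -> S a -> S (a ^+ m).
Proof.
move=> fS Sa; elim: m => [|m IHm]; first by case: fS.
by rewrite exprS; apply: subfieldM.
Qed.

Lemma subfield_genP A : is_subfield (subfield_gen A).
Proof.
split=> [S [] // | a b Aa Ab S fS AS | a b Aa Ab S fS AS].
  by case: (fS) => _ SB _; apply: SB; [apply: Aa | apply: Ab].
by case: (fS) => _ _ SV; apply: SV; [apply: Aa | apply: Ab].
Qed.

Lemma equalizer_subfield (R : fieldType) (phi psi : {rmorphism E -> R}) :
  is_subfield (fun f => phi f = psi f).
Proof.
split=> [|a b ea eb|a b ea eb]; first by rewrite !rmorph1.
  by rewrite !rmorphB ea eb.
by rewrite !fmorph_div ea eb.
Qed.
End Subfields.

(** An induction principle for rational functions. Applied to the equalizer of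
    two ring morphisms, it shows that they agree as soon as they agree on
    constants and indeterminates. *)
Lemma ratfun_generated (K : fieldType) (n : nat) (S : ratfun K n -> Prop) :
    is_subfield S -> (forall c, S (ratC n c)) -> (forall i, S (ratX K i)) ->
  forall f, S f.
Proof.
move=> fS SC SX.
have SP (p : {mpoly K[n]}) : S (@FracField.tofrac {mpoly K[n]} p).
  elim/mpolyind: p => [|c m p _ _ Sp]; first by rewrite rmorph0; apply: subfield0.
  rewrite rmorphD; apply: subfieldD => //.
  rewrite -mul_mpolyC rmorphM; apply: subfieldM => //; first exact: (SC c).
  rewrite mpolyXE_id rmorph_prod; apply: (big_ind S).
  - by case: fS.
  - by move=> a b; apply: subfieldM.
  by move=> i _; rewrite rmorphXn; apply: subfieldX => //; apply: SX.
by move=> f; rewrite [f]ratfun_repr; case: (fS) => _ _ SV; apply: SV.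
Qed.

(** * The action in the coordinates 1 / (1 + x) *)

Section IntPower.
Variable R : fieldType.

Lemma exprz_prod (I : Type) (r : seq I) (f : I -> R) (z : int) :
  (\prod_(i <- r) f i) ^ z = \prod_(i <- r) f i ^ z.
Proof.
by apply: (big_morph (fun x => x ^ z)) => [a b|]; [apply: expfzMl | apply: exp1rz].
Qed.

Lemma expfz_sum (I : Type) (r : seq I) (x : R) (z : I -> int) :
  x != 0 -> x ^ (\sum_(i <- r) z i) = \prod_(i <- r) x ^ z i.
Proof.
by move=> x0; apply: (big_morph (fun m => x ^ m)) => // a b; apply: expfzDr.
Qed.

Lemma invD1V (x : R) : x != 0 -> 1 + x != 0 -> (1 + x^-1)^-1 = 1 - (1 + x)^-1.
Proof.
move=> x0 x1; have -> : 1 + x^-1 = (1 + x) / x.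
  by rewrite mulrDl mul1r mulfV // addrC.
rewrite invf_div; apply: (mulIf x1).
by rewrite divfK // mulrBl mul1r mulVf // addrC addKr.
Qed.
End IntPower.

Section Action.
Variables (K : fieldType) (n : nat).
Implicit Types (g h : signed_perm n) (f : ratfun K n).

Lemma ratX_neq0 i : ratX K i != 0 :> ratfun K n.
Proof.
rewrite tofrac_eq0; apply/eqP => /(congr1 (mcoeff U_(i))) /eqP.
by rewrite mcoeffXU eqxx mcoeff0 oner_eq0.
Qed.

Lemma ratX1_neq0 i : 1 + ratX K i != 0 :> ratfun K n.
Proof.
rewrite -(rmorph1 (@FracField.tofrac {mpoly K[n]})) -rmorphD tofrac_eq0.
apply/eqP => /(congr1 (mcoeff U_(i))) /eqP.
by rewrite mcoeffD mcoeffXU eqxx mcoeff1 mnm1_eq0 add0r mcoeff0 oner_eq0.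
Qed.

(** Both sides are ring morphisms, so constants and indeterminates suffice. On
    the latter, the exponents compose by the matrix product. *)
Lemma sp_act_comp (s t u : {rmorphism K -> K}) g h f :
  (forall c, u c = s (t c)) ->
  sp_act s g (sp_act t h f) = sp_act u (g * h)%g f.
Proof.
move=> uE; pose phi : {rmorphism ratfun K n -> ratfun K n} := sp_act s g \o sp_act t h.
pose psi : {rmorphism ratfun K n -> ratfun K n} := sp_act u (g * h)%g.
apply: (ratfun_generated (equalizer_subfield phi psi)) => [c|i] /=.
  by rewrite !sp_actC uE.
rewrite !sp_actX rmorph_prod.
under eq_bigr do rewrite fmorphXz /= sp_actX exprz_prod.
rewrite exchange_big; apply: eq_bigr => k _ /=.
rewrite mxE expfz_sum ?ratX_neq0 //.
by apply: eq_bigr => j _; rewrite exprz_exp.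
Qed.

Lemma sp_act1 (s : {rmorphism K -> K}) f :
  (forall c, s c = c) -> sp_act s 1%g f = f.
Proof.
move=> s1; pose phi : {rmorphism ratfun K n -> ratfun K n} := sp_act s 1%g.
apply: (ratfun_generated (equalizer_subfield phi idfun)) => [c|i] /=.
  by rewrite sp_actC s1.
rewrite sp_actX (bigD1 i) //= big1 => [|j /negPf ji]; rewrite mxE.
  by rewrite eqxx expr1z mulr1.
by rewrite ji.
Qed.

(** The coordinate on which inversion of the indeterminate becomes affine. *)
Definition affX (i : 'I_n) : ratfun K n := (1 + ratX K i)^-1.

(** Column [i] of [g] has a single nonzero entry, [1] or [-1]. In the second
    case [x_i] is sent to some [x_k^-1], and [1 / (1 + x_k^-1)] is
    [1 - 1 / (1 + x_k)]: the constant term records the sign. *)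
Lemma sp_act_affX (s : {rmorphism K -> K}) g i :
  sp_act s g (affX i) =
    \sum_j (g j i)%:~R * affX j + [exists j, g j i == -1]%:R.
Proof.
have /signed_perm_mxP[p [e gE]] := sp_mxP g.
pose k := (p^-1)%g i; have pk : p k = i by rewrite permKV.
have gki : g k i = (-1) ^+ e k by rewrite gE pk eqxx.
have gji j : j != k -> g j i = 0.
  by rewrite gE -pk (inj_eq perm_inj) => /negPf ->.
have -> : [exists j, g j i == -1] = e k.
  apply/existsP/idP => [[j]|ek]; last by exists k; rewrite gki ek.
  have [-> | /gji-> //] := eqVneq j k; rewrite gki.
  by case: (e k).
rewrite /affX fmorphV rmorphD rmorph1 /= sp_actX.
rewrite (bigD1 k) //= big1 => [|j /gji -> //]; rewrite mulr1.
rewrite (bigD1 k) //= big1 => [|j /gji -> //]; last by rewrite mul0r.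
rewrite addr0 gki; case: (e k); last by rewrite expr0 expr1z mul1r addr0.
rewrite expr1 exprN1 rmorphN1 mulN1r.
have X0 := ratX_neq0 k; have X1 := ratX1_neq0 k.
by rewrite (invD1V X0 X1) [RHS]addrC mulr1n.
Qed.
End Action.

(** * Descent of invariants from the span of an invariant subfield *)

Section Descent.
Variables (n : nat) (F : fieldType) (K : splittingFieldType F).
Variables (G : {group signed_perm n}) (iota : signed_perm n -> gal_of {:K}).
Hypotheses (hK : galois 1 {:K}) (hiota : galois_iso G iota).
Variable alpha : K.
Hypothesis halpha : normal_element alpha.
Local Notation E := (ratfun K n).
Local Notation act g := (sp_act (iota g) g).

Lemma actM g h (f : E) : g \in G -> h \in G -> act g (act h f) = act (g * h)%g f.
Proof. by move=> Gg Gh; apply: sp_act_comp => c; apply: (iota_mul hiota). Qed.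

Lemma orbit_sum_fixed (f : E) : fixed_ratfun G iota (\sum_(g in G) act g f).
Proof.
move=> h Gh; rewrite rmorph_sum [RHS](reindex_inj (mulgI h)) /=.
by apply: eq_big => g; rewrite ?groupMl // => Gg; rewrite actM.
Qed.

Lemma orbit_prod_fixed (f : E) : fixed_ratfun G iota (\prod_(g in G) act g f).
Proof.
move=> h Gh; rewrite rmorph_prod [RHS](reindex_inj (mulgI h)) /=.
by apply: eq_big => g; rewrite ?groupMl // => Gg; rewrite actM.
Qed.

Variable L : E -> Prop.
Hypotheses (fL : is_subfield L) (LF : forall a : F, L (ratC n a%:A)).
Hypothesis L_fixed : forall f, L f -> fixed_ratfun G iota f.

(** The K-span of [L], which is the ring generated by K and [L]. *)
Inductive kspan : E -> Prop :=
| kspan0 : kspan 0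
| kspanD c l f : L l -> kspan f -> kspan (ratC n c * l + f).

Lemma kspan_scale c l : L l -> kspan (ratC n c * l).
Proof. by move=> Ll; rewrite -[_ * _]addr0; apply: kspanD => //; apply: kspan0. Qed.

Lemma kspan_sub l : L l -> kspan l.
Proof. by rewrite -[X in kspan X]mul1r -(rmorph1 (ratC n)); apply: kspan_scale. Qed.

Lemma kspan_const c : kspan (ratC n c).
Proof. by rewrite -[ratC n c]mulr1; apply: kspan_scale; case: fL. Qed.

Lemma kspan_add e f : kspan e -> kspan f -> kspan (e + f).
Proof.
by move=> Te Tf; elim: Te => [|c l e' Ll _ IH]; rewrite ?add0r // -addrA; apply: kspanD.
Qed.

Lemma kspan_mul e f : kspan e -> kspan f -> kspan (e * f).
Proof.
move=> Te Tf; elim: Te => [|c l e' Ll _ IH]; first by rewrite mul0r; apply: kspan0.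
rewrite mulrDl; apply: kspan_add => {IH}//.
elim: Tf => [|d m f' Lm _ IH]; first by rewrite mulr0; apply: kspan0.
by rewrite mulrDr mulrACA -rmorphM; apply: kspanD => //; apply: subfieldM.
Qed.

Lemma kspan_act g f : g \in G -> kspan f -> kspan (act g f).
Proof.
move=> Gg; elim=> [|c l e Ll _ IH]; first by rewrite rmorph0; apply: kspan0.
by rewrite rmorphD rmorphM /= sp_actC (L_fixed Ll Gg); apply: kspanD.
Qed.

(** Elements of [L] are invariant, so on K-multiples of them the orbit sum acts
    through the trace of K/F, with values in F. *)
Lemma orbit_sum_kspan f : kspan f -> L (\sum_(g in G) act g f).
Proof.
elim=> [|c l e Ll _ IH].
  by rewrite big1 => [|g _]; [apply: subfield0 | rewrite rmorph0].
under eq_bigr do rewrite rmorphD; rewrite big_split; apply: subfieldD => //.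
rewrite (eq_bigr (fun g => ratC n (iota g c) * l)) => [|g Gg]; last first.
  by rewrite rmorphM /= sp_actC (L_fixed Ll Gg).
rewrite -mulr_suml -rmorph_sum; apply: subfieldM => //.
by have [a tra] := trace_scalar hK hiota c; rewrite /trace in tra; rewrite tra; apply: LF.
Qed.

(** The orbit sum of [alpha * f] is [f] times the trace of [alpha], a nonzero
    element of F. *)
Lemma kspan_fixed f : kspan f -> fixed_ratfun G iota f -> L f.
Proof.
move=> Tf fixf; have := orbit_sum_kspan (kspan_mul (kspan_const alpha) Tf).
rewrite (eq_bigr (fun g => ratC n (iota g alpha) * f)) => [|g Gg]; last first.
  by rewrite rmorphM /= sp_actC fixf.
rewrite -mulr_suml -rmorph_sum.
have [a tra] := trace_scalar hK hiota alpha; have := trace_normal hiota halpha.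
rewrite /trace in tra *; rewrite tra => a0 Laf.
have ra0 : ratC n (a%:A : K) != 0.
  by apply: contra_neq a0 => ra0; apply: (fmorph_inj (ratC n)); rewrite rmorph0.
by rewrite -[f](mulKf ra0); apply: subfieldM => //; apply: subfieldV.
Qed.

(** The inverse of [b] is the product of its other conjugates divided by its
    norm, and the norm is in [L] by [kspan_fixed]. *)
Lemma kspan_subfield : is_subfield kspan.
Proof.
have TN f : kspan f -> kspan (- f).
  rewrite -mulN1r -(rmorphN1 (ratC n)) => Tf.
  by apply: kspan_mul => //; apply: kspan_const.
split=> [|a b Ta Tb|a b Ta Tb]; first by apply: kspan_sub; case: fL.
  by apply: kspan_add => //; apply: TN.
apply: kspan_mul => //; have [-> | b0] := eqVneq b 0.
  by rewrite invr0; apply: kspan0.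
have TP (P : pred (signed_perm n)) : kspan (\prod_(g in G | P g) act g b).
  apply: big_ind => [|c d|g /andP[Gg _]]; last exact: kspan_act.
  - by apply: kspan_sub; case: fL.
  - exact: kspan_mul.
have LN : L (\prod_(g in G) act g b).
  apply: kspan_fixed (orbit_prod_fixed b).
  by have := TP xpredT; under eq_bigl do rewrite andbT.
have NE : \prod_(g in G) act g b = b * \prod_(g in G | g != 1%g) act g b.
  by rewrite (bigD1 1%g) //= sp_act1 // => c; apply: (iota1 hiota).
have P0 : \prod_(g in G | g != 1%g) act g b != 0.
  by apply/prodf_neq0 => g _; rewrite fmorph_eq0.
have -> : b^-1 = (\prod_(g in G | g != 1%g) act g b) / \prod_(g in G) act g b.
  by rewrite NE invfM mulrCA mulfV // mulr1.
by apply: kspan_mul; [apply: TP | apply: kspan_sub; apply: subfieldV].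
Qed.

(** As K and [L] generate K(x_1, ..., x_n), the field [kspan] is everything, and
    [kspan_fixed] applies to every invariant. *)
Lemma fixed_field_descent :
    (forall S, is_subfield S -> (forall c, S (ratC n c)) ->
       (forall f, L f -> S f) -> forall f, S f) ->
  forall f, fixed_ratfun G iota f -> L f.
Proof.
move=> gen f; apply: kspan_fixed; apply: gen f.
- exact: kspan_subfield.
- exact: kspan_const.
- exact: kspan_sub.
Qed.
End Descent.

(** * The field of invariants *)

Theorem theorem3 (n : nat) (hn : (0 < n)%N) (F : fieldType)
    (K : splittingFieldType F) (hK : galois 1 {:K})
    (G : {group signed_perm n}) (iota : signed_perm n -> gal_of {:K})
    (hiota : galois_iso G iota) (alpha : K) (halpha : normal_element alpha)
    (y : 'I_n -> ratfun K n)
    (hy : forall i, y i = \sum_(g in G)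
       sp_act (iota g) g (ratC n alpha / (1 + ratX K i))) :
  forall f : ratfun K n, fixed_ratfun G iota f <-> adjoin_ratfun y f.
Proof.
have adjoin_fixed f : adjoin_ratfun y f -> fixed_ratfun G iota f.
  move=> yf g Gg; pose phi : {rmorphism ratfun K n -> ratfun K n} := sp_act (iota g) g.
  apply: (yf _ (equalizer_subfield phi idfun)) => _ [[c ->] | [i ->]] /=.
    by rewrite sp_actC /= linearZ /= rmorph1.
  by rewrite hy; apply: (orbit_sum_fixed hiota).
move=> f; split; last exact: adjoin_fixed.
apply: (fixed_field_descent hK hiota halpha _ _ adjoin_fixed) f => [||S fS SC Sy].
- exact: subfield_genP.
- by move=> a S fS; apply; left; exists a.
have {}Sy i : S (y i) by apply: Sy => S' fS'; apply; right; exists i.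
pose A := twist_mx G iota alpha.
pose b i := \sum_(g in G) iota g alpha * [exists j, g j i == -1]%:R.
have yE i : y i = \sum_j ratC n (A i j) * affX K j + ratC n (b i).
  rewrite hy /b rmorph_sum.
  under [X in _ = X + _]eq_bigr do rewrite mxE rmorph_sum mulr_suml.
  rewrite exchange_big -big_split; apply: eq_bigr => g Gg /=.
  rewrite rmorphM /= sp_actC sp_act_affX mulrDr mulr_sumr rmorphM rmorph_nat.
  by congr (_ + _); apply: eq_bigr => j _; rewrite mulrA rmorphM rmorph_int.
have AV : invmx A *m A = 1%:M by rewrite mulVmx // (twist_mx_unit hK hiota halpha).
have affXE i : affX K i = \sum_j ratC n (invmx A i j) * (y j - ratC n (b j)).
  under eq_bigr do rewrite yE addrK mulr_sumr.
  rewrite exchange_big (bigD1 i) //= [X in _ + X]big1 => [|k ki].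
    under eq_bigr do rewrite mulrA -rmorphM.
    rewrite -mulr_suml -rmorph_sum.
    by have /matrixP/(_ i i) := AV; rewrite !mxE eqxx => ->; rewrite rmorph1 mul1r addr0.
  under eq_bigr do rewrite mulrA -rmorphM.
  rewrite -mulr_suml -rmorph_sum.
  have /matrixP/(_ i k) := AV; rewrite !mxE eq_sym (negPf ki) => ->.
  by rewrite rmorph0 mul0r.
apply: ratfun_generated => // i.
have -> : ratX K i = (affX K i)^-1 - 1 by rewrite invrK addrC addKr.
case: (fS) => S1 SB _; apply: SB => //; apply: subfieldV => //.
rewrite affXE; apply: subfield_sum => // j _; apply: subfieldM => //.
by case: (fS) => _ SB _; apply: SB.
Qed.
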